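(* Let $G$ be a group having a nilpotent subnormal subgroup $H$ which is contained in the hypercentre of $G$ and which is an Aut-basis of $G$. Then $G$ is nilpotent.
   Context: A subset $X$ of a group $G$ is an Aut-basis of $G$ if any two automorphisms of $G$ having the same restriction to $X$ are equal. The hypercentre of $G$ is the last term of the (transfinitely continued) upper central series of $G$. *)

(* Defs.v *)
From mathcomp Require Import all_boot monoid.
From mathcomp Require Import boolp classical_sets wochoice.

Set Implicit Arguments.
Unset Strict Implicit.
Unset Printing Implicit Defensive.

Local Open Scope group_scope.
Local Open Scope classical_set_scope.

Definition subgroup (G : groupType) (H : set G) : Prop := group_closed [in H].

Definition normal_in (G : groupType) (N K : set G) : Prop :=
  [/\ subgroup N, subgroup K, N `<=` K &
      forall x g, N x -> K g -> N (x ^ g)].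

Definition subnormal (G : groupType) (H : set G) : Prop :=
  subgroup H /\
  exists (n : nat) (K : nat -> set G),
    [/\ K 0 = H, K n = [set: G] &
        forall i : nat, (i < n)%N -> normal_in (K i) (K i.+1)].

Definition Aut_basis (G : groupType) (X : set G) : Prop :=
  forall f g : {multiplicative G -> G}, bijective f -> bijective g ->
    (forall x, X x -> f x = g x) -> forall x, f x = g x.

(* The preimage in H of the centre of H / Z, when Z is normal in H:
   xZ is central in H / Z iff [~ x, h] \in Z for every h in H. *)
Definition centre_mod (G : groupType) (H Z : set G) : set G :=
  [set x | H x /\ forall h, H h -> Z [~ x, h]].

(* The finite part of the upper central series of H. *)
Definition ucs (G : groupType) (H : set G) (n : nat) : set G :=
  iter n (centre_mod H) [set 1].

Definition nilpotent (G : groupType) (H : set G) : Prop :=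
  exists n, ucs H n = H.

Section Ordinals.
Variables (I : eqType) (R : rel I).

(* R is the reflexive order, as in well_order. *)
Definition before (j i : I) : Prop := R j i /\ j <> i.

Definition is_zero (i : I) : Prop := forall j, ~ before j i.

Definition is_succ (j i : I) : Prop :=
  before j i /\ forall k, ~ (before j k /\ before k i).

Definition is_limit (i : I) : Prop := ~ is_zero i /\ forall j, ~ is_succ j i.

End Ordinals.

(* Ordinals are represented as the elements of a well-ordered type; Z is the
   upper central series of G continued transfinitely along that type. *)
Definition transfinite_ucs (G : groupType) (I : eqType) (R : rel I)
    (Z : I -> set G) : Prop :=
  [/\ forall i, is_zero R i -> Z i = [set 1],
      forall j i, is_succ R j i -> Z i = centre_mod [set: G] (Z j) &
      forall i, is_limit R i -> Z i = \bigcup_(j in [set j | before R j i]) Z j].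

(* K is the last term: the term at which the series becomes stationary. *)
Definition is_hypercentre (G : groupType) (K : set G) : Prop :=
  exists (I : eqType) (R : rel I) (Z : I -> set G) (i : I),
    [/\ well_order R, transfinite_ucs R Z, Z i = K &
        centre_mod [set: G] K = K].

(* There is exactly one K with is_hypercentre K: see hypercentreP and
   is_hypercentre_uniq below. *)
Definition hypercentre (G : groupType) : set G :=
  \bigcup_(K in @is_hypercentre G) K.
Arguments hypercentre : clear implicits.

Lemma centre_mod_mono (G : groupType) (H Z Z' : set G) :
  Z `<=` Z' -> centre_mod H Z `<=` centre_mod H Z'.
Proof. by move=> sZ x [Hx cx]; split=> // h /cx /sZ. Qed.

Section WellOrder.
Variables (I : eqType) (R : rel I).
Hypothesis wo : well_order R.

Let woC : wo_chain R predT.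
Proof. by move=> A _; apply: wo. Qed.

Lemma wo_total i j : R i j || R j i.
Proof. exact: (wo_chainW woC). Qed.

Lemma wo_anti i j : R i j -> R j i -> i = j.
Proof. by move=> ij ji; apply: (wo_chain_antisymmetric woC) => //; apply/andP. Qed.

Lemma wo_trans i j k : R i j -> R j k -> R i k.
Proof.
move=> ij jk.
have /wo[m [[mA lm] _]] : nonempty [pred l | l \in [:: i; j; k]].
  by exists i; apply: mem_head.
have mi : R m i by apply: lm; rewrite !inE eqxx.
have mj : R m j by apply: lm; rewrite !inE eqxx orbT.
have mk : R m k by apply: lm; rewrite !inE eqxx !orbT.
move: mA; rewrite !inE => /or3P[] /eqP em; rewrite em in mi mj mk => //.
- by rewrite (wo_anti ij mi).
- by rewrite -(wo_anti jk mj).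
Qed.

Lemma before_trans i j k : before R i j -> before R j k -> before R i k.
Proof.
move=> [ij nij] [jk njk]; split; first exact: wo_trans jk.
by move=> eik; subst k; apply: nij; apply: wo_anti.
Qed.

Lemma before_irr i : ~ before R i i. Proof. by case. Qed.

Lemma before_total i j : [\/ before R i j, i = j | before R j i].
Proof.
have [->|nij] := pselect (i = j); first by constructor 2.
case/orP: (wo_total i j) => h; [constructor 1|constructor 3]; split=> //.
by move=> ji; apply: nij.
Qed.

Lemma before_wf : well_founded (before R).
Proof.
move=> i; apply: contrapT => ni.
pose A : {pred I} := [pred j | `[< ~ Acc (before R) j >]].
have /wo[z [[/asboolP Az lb] _]] : nonempty A by exists i; apply/asboolP.
apply: Az; constructor=> j [Rjz njz]; apply: contrapT => nj.
by apply/njz/wo_anti => //; apply: lb; apply/asboolP.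
Qed.

Lemma ordinal_cases i :
  [\/ is_zero R i, exists j, is_succ R j i | is_limit R i].
Proof.
have [z|nz] := pselect (is_zero R i); first by constructor 1.
have [s|ns] := pselect (exists j, is_succ R j i); first by constructor 2.
by constructor 3; split=> // j js; apply: ns; exists j.
Qed.

Variable G : groupType.

Lemma transfinite_ucs1 (Z : I -> set G) i : transfinite_ucs R Z -> Z i 1.
Proof.
move=> [Z0 ZS ZL]; elim/(well_founded_ind before_wf): i => i IH.
case: (ordinal_cases i) => [zi|[j ji]|li].
- by rewrite Z0.
- rewrite (ZS _ _ ji); split=> // h _; rewrite comm1g.
  by apply: IH; case: ji.
- rewrite ZL //; case: (li) => /existsNP[j /contrapT ji] _.
  by exists j => //; apply: IH.
Qed.

Lemma transfinite_ucs_sub (Z : I -> set G) (K : set G) i :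
  transfinite_ucs R Z -> K 1 -> centre_mod [set: G] K = K -> Z i `<=` K.
Proof.
move=> [Z0 ZS ZL] K1 cK; elim/(well_founded_ind before_wf): i => i IH.
case: (ordinal_cases i) => [zi|[j ji]|li].
- by rewrite Z0 // => x ->.
- rewrite (ZS _ _ ji) -cK; apply: centre_mod_mono.
  by apply: IH; case: ji.
- by rewrite ZL // => x [j ji] /IH; apply.
Qed.

Lemma transfinite_ucs_exists :
  exists Z : I -> set G, transfinite_ucs R Z /\
    (forall j i, before R j i -> centre_mod [set: G] (Z j) `<=` Z i) /\
    (forall i, Z i `<=` centre_mod [set: G] (Z i)).
Proof.
pose F i (rec : forall j, before R j i -> set G) : set G :=
  [set x | x = 1 \/
     exists j (ji : before R j i), centre_mod [set: G] (rec j ji) x].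
pose Z := Fix before_wf (fun=> set G) F.
have ZE i : Z i = [set x | x = 1 \/
    exists j, before R j i /\ centre_mod [set: G] (Z j) x].
  rewrite /Z Fix_eq => [|k f g fg]; last first.
    by congr F; apply: functional_extensionality_dep => j;
      apply: functional_extensionality_dep => jk; apply: fg.
  apply/seteqP; split=> x /= [->|]; [by left| |by left|].
  - by move=> [j [ji h]]; right; exists j.
  - by move=> [j [ji h]]; right; exists j, ji.
have Z1 i : Z i 1 by rewrite ZE; left.
have Zc j i : before R j i -> centre_mod [set: G] (Z j) `<=` Z i.
  by move=> ji x xj; rewrite ZE; right; exists j.
have Zle j i : before R j i -> Z j `<=` Z i.
  move=> ji x; rewrite ZE => -[->|[k [kj xk]]]; first exact: Z1.
  by apply: (Zc k) => //; apply: before_trans ji.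
have Zn i : Z i `<=` centre_mod [set: G] (Z i).
  move=> x; rewrite {1}ZE => -[->|[j [ji [_ xj]]]]; split=> // h _.
    by rewrite comm1g.
  by apply: (Zle j) => //; apply: xj.
exists Z; split; last by [].
split=> [i zi|j i ji|i [nz ns]].
- apply/seteqP; split=> x; last by move=> ->.
  by rewrite ZE => -[->//|[j [/zi]]].
- have [ji' nji] := ji; apply/seteqP; split; last exact: Zc.
  move=> x; rewrite ZE => -[->|[k [ki]]].
    by split=> // h _; rewrite comm1g.
  apply: centre_mod_mono.
  case: (before_total k j) => [|->//|jk]; first exact: Zle.
  by case: (nji k).
- apply/seteqP; split=> x; last by move=> [j ji]; apply: Zle.
  rewrite ZE => -[->|[j [ji xj]]].
    by move/existsNP: nz => [j /contrapT ji]; exists j.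
  move: (ns j) => /not_andP[//|/existsNP[k /contrapT[jk ki]]].
  by exists k => //; apply: Zc xj.
Qed.

End WellOrder.

Lemma is_hypercentre_uniq (G : groupType) (K K' : set G) :
  is_hypercentre K -> is_hypercentre K' -> K = K'.
Proof.
move=> [I [R [Z [i [wo uZ <- cK]]]]] [I' [R' [Z' [i' [wo' uZ' <- cK']]]]].
have K1 := transfinite_ucs1 wo i uZ; have K1' := transfinite_ucs1 wo' i' uZ'.
apply/seteqP; split.
- exact: (transfinite_ucs_sub wo uZ K1' cK').
- exact: (transfinite_ucs_sub wo' uZ' K1 cK).
Qed.

Lemma is_hypercentre_exists (G : groupType) : exists K : set G, is_hypercentre K.
Proof.
pose I : eqType := {classic set (set G)}.
have [R wo] := well_ordering_principle I.
have [Z [uZ [Zc Zn]]] := transfinite_ucs_exists wo G.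
have [[i ci]|nst] := pselect (exists i, centre_mod [set: G] (Z i) = Z i).
  by exists (Z i), I, R, Z, i.
have Zlt i j : before R i j -> Z i <> Z j.
  move=> ij e; apply: nst; exists i; apply/seteqP; split; last exact: Zn.
  by rewrite {2}e; apply: Zc.
have Zinj i j : Z i = Z j -> i = j.
  by case: (before_total wo i j) => [/Zlt//|//|/Zlt h /esym].
pose D : set (set G) := [set A | exists S : set (set G), Z S = A /\ ~ S A].
have [DD|nD] := pselect (D (Z D)); last by case: (nD); exists D.
by case: (DD) => S [/Zinj SD]; rewrite SD.
Qed.

Lemma hypercentreP (G : groupType) : is_hypercentre (hypercentre G).
Proof.
have [K hK] := is_hypercentre_exists G.
suff -> : hypercentre G = K by [].
apply/seteqP; split=> x; last by exists K.
by move=> [K' hK']; rewrite (is_hypercentre_uniq hK hK').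
Qed.

(* Main.v *)
Require Import Defs.
From HB Require Import structures.
From mathcomp Require Import all_boot monoid.
From mathcomp Require Import boolp classical_sets wochoice.

(** Write Z_k for the k-th term of the upper central series of G, and
    [y, h_1, ..., h_k] for the left-normed commutator. An Aut-basis H acts on
    the proof only through two families of automorphisms. Inner automorphisms
    show that whatever centralizes H is central ([Aut_basis_cent]). Central
    automorphisms g |-> g f(g), with f : G -> Z_1 a homomorphism killing Z_1,
    show that such an f vanishes as soon as it vanishes on H
    ([Aut_basis_central_hom]).

    The key is [Aut_basis_ucs]: if y is in Z_(k+1) and [y, h_1, ..., h_k] = 1
    for all h_i in H, then y is in Z_k. Indeed, for fixed h_2, ..., h_k, the map
    g |-> [y, g, h_2, ..., h_k] is a homomorphism into Z_1, because commutators
    are multilinear along the upper central series; it kills Z_1, and it kills H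
    by hypothesis, so it is trivial. Thus each [y, g], which lies in Z_k,
    satisfies the same hypothesis with k - 1 in place of k, and induction puts
    it in Z_(k-1).

    If H is subnormal of defect n, then [y, h_1, ..., h_n] is in H for every y
    in G, so if H has class c all [y, h_1, ..., h_(n+c)] are trivial. With
    m = n + c the key statement then says Z_(m+1) = Z_m: the hypercentre is the
    finite term Z_m, and H is contained in it.

    Finally G stabilizes the finite central series Z_m > ... > Z_0, so deep
    enough commutators of elements of G centralize Z_m, hence H, hence are
    central; this makes G nilpotent ([nilpotent_of_cent_ucs]). *)

Local Open Scope classical_set_scope.

Set Implicit Arguments.
Unset Strict Implicit.

Arguments ucs : simpl never.

(** * Commutator identities *)

Section CommutatorIdentities.
Local Open Scope group_scope.
Variable G : groupType.
Implicit Types x y g h : G.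

Lemma conjg_mulR x g : x ^ g = x * [~ x, g].
Proof. by rewrite commgEl mulVKg. Qed.

Lemma commMgE x y h : [~ x * y, h] = [~ x, h] * [~ [~ x, h], y] * [~ y, h].
Proof.
by rewrite -conjg_mulR [LHS]commgEl conjMg invgM !commgEl /conjg !mulgA !mulgK.
Qed.

Lemma commgME x g h : [~ x, g * h] = [~ x, h] * [~ x, g] * [~ [~ x, g], h].
Proof.
by rewrite -(mulgA _ [~ x, g]) -conjg_mulR !commgEl /conjg invgM !mulgA !mulgK.
Qed.

Lemma commVgE x h : [~ x^-1, h] = ([~ x, h]^-1) ^ x^-1.
Proof. by rewrite !commgEl /conjg !invgM !invgK !mulgA mulgK. Qed.

End CommutatorIdentities.

(** * Multilinear commutators on the upper central series *)

Section UpperCentralSeries.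
Local Open Scope group_scope.
Variable G : groupType.
Implicit Types (x y g h : G) (s : seq G) (k j : nat).

Local Notation Z := (ucs [set: G]).

Lemma ucsP k x : Z k.+1 x <-> forall g, Z k [~ x, g].
Proof. by split=> [[_ xZ] g|xZ]; [apply: xZ | split]. Qed.

Lemma ucsS_commg k x g : Z k.+1 x -> Z k [~ x, g].
Proof. by move/ucsP. Qed.

Lemma ucs_group1 k : Z k 1.
Proof. by elim: k => // k IH; apply/ucsP => g; rewrite comm1g. Qed.

Lemma ucs_ascending k : Z k `<=` Z k.+1.
Proof.
elim: k => [x ->|k IH]; first exact: ucs_group1.
exact: centre_mod_mono IH.
Qed.

Lemma ucs_commg k x g : Z k x -> Z k [~ x, g].
Proof. by move=> /ucs_ascending/ucsS_commg. Qed.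

Lemma ucs_groupM k x y : Z k x -> Z k y -> Z k (x * y).
Proof.
elim: k x y => [x y -> ->|k IH x y /ucsP xZ /ucsP yZ]; first exact: mulg1.
apply/ucsP => h; rewrite commMgE; apply: (IH _ _ _ (yZ h)).
exact: IH (xZ h) (ucs_commg _ (xZ h)).
Qed.

Lemma ucs_conj k x g : Z k x -> Z k (x ^ g).
Proof.
by move=> xZ; rewrite conjg_mulR; apply: ucs_groupM => //; apply: ucs_commg.
Qed.

Lemma ucs_groupV k x : Z k x -> Z k x^-1.
Proof.
elim: k x => [x ->|k IH x /ucsP xZ]; first exact: invg1.
by apply/ucsP => h; rewrite commVgE; apply/ucs_conj/IH.
Qed.

Lemma ucs1_commute x g : Z 1 x -> x * g = g * x.
Proof. by move/ucsP/(_ g)/eqP/commgP. Qed.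

Lemma commg_ucs1 x g : Z 1 g -> [~ x, g] = 1.
Proof. by move=> gZ; apply/eqP/commgP/esym/ucs1_commute. Qed.

Definition commgs (y : G) (s : seq G) : G := foldl (@commg G) y s.

Lemma commgs1 s : commgs 1 s = 1.
Proof. by elim: s => //= h s IH; rewrite comm1g. Qed.

Lemma commgs_ucs y s j : Z (size s + j)%N y -> Z j (commgs y s).
Proof. by elim: s y => //= h s IH y /ucsP/(_ h)/IH. Qed.

Lemma commgs_ucs_size y s : Z (size s) y -> commgs y s = 1.
Proof. by rewrite -(addn0 (size s)) => /commgs_ucs. Qed.

(** Each [_, h] maps a product to the product of the commutators up to an error
    that lies one term lower in the upper central series, and the remaining
    commutators in s kill this error. *)
Lemma commgsM y1 y2 s : Z (size s).+1 y1 -> Z (size s).+1 y2 ->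
  commgs (y1 * y2) s = commgs y1 s * commgs y2 s.
Proof.
elim: s y1 y2 => //= h s IH y1 y2 /ucsP y1Z /ucsP y2Z.
have zZ : Z (size s) [~ [~ y1, h], y2] by apply: ucsS_commg.
have z'Z := ucs_ascending zZ.
rewrite commMgE (IH _ _ (ucs_groupM (y1Z h) z'Z) (y2Z h)) (IH _ _ (y1Z h) z'Z).
by rewrite (commgs_ucs_size zZ) mulg1.
Qed.

(** Linearity in the second entry. The commutator identity reverses the order of
    the factors, which is harmless since the values are central. *)
Lemma commgs_commg_morph y s : Z (size s).+2 y ->
  {morph (fun g => commgs [~ y, g] s) : a b / a * b}.
Proof.
move=> /ucsP yZ a b /=.
have zZ : Z (size s) [~ [~ y, a], b] by apply: ucsS_commg.
rewrite commgME (commgsM (ucs_groupM (yZ b) (yZ a)) (ucs_ascending zZ)).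
rewrite commgsM // (commgs_ucs_size zZ) mulg1.
by apply: ucs1_commute; apply: commgs_ucs; rewrite addn1.
Qed.

End UpperCentralSeries.

(** * Consequences of the Aut-basis property *)

Section AutBasis.
Local Open Scope group_scope.
Variables (G : groupType) (X : set G).
Hypothesis autX : Aut_basis X.

Local Notation Z := (ucs [set: G]).

Lemma Aut_basis_cent g : (forall x, X x -> [~ x, g] = 1) -> Z 1%N g.
Proof.
move=> cXg; pose c (x : G) := x ^ g.
have cM : {morph c : x y / x * y} by move=> x y; apply: conjMg.
pose cP := isMultiplicative.Build G G c cM.
pose cA : {multiplicative G -> G} := HB.pack c cP.
have cB : bijective c.
  by exists (fun x => x ^ g^-1) => x; [apply: conjgK | apply: conjgKV].
have iB : bijective (idfun : G -> G) by exists idfun.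
have cE x : x ^ g = x.
  apply: (autX (f := cA) (g := idfun) cB iB) => y Xy /=.
  by rewrite /c conjg_mulR cXg // mulg1.
apply/ucsP => x; apply/eqP; rewrite commg1_sym; apply/eqP.
by rewrite commgEl cE mulVg.
Qed.

(** Since f kills the centre and takes central values, f o f = 1, so that
    x |-> x f(x) is an automorphism with inverse x |-> x f(x)^-1; it agrees with
    the identity wherever f vanishes. *)
Lemma Aut_basis_central_hom (f : G -> G) :
    {morph f : a b / a * b} -> (forall a, Z 1%N (f a)) ->
    (forall a, Z 1%N a -> f a = 1) -> (forall x, X x -> f x = 1) ->
  forall a, f a = 1.
Proof.
move=> fM fZ Zf Xf; pose c (x : G) := x * f x.
have cM : {morph c : x y / x * y}.
  move=> x y; rewrite /c fM !mulgA -(mulgA x y).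
  by rewrite -(ucs1_commute y (fZ x)) !mulgA.
pose cP := isMultiplicative.Build G G c cM.
pose cA : {multiplicative G -> G} := HB.pack c cP.
have cB : bijective c.
  exists (fun x => x * (f x)^-1) => x; rewrite /c fM.
    by rewrite (Zf _ (fZ x)) mulg1 mulgK.
  by rewrite (Zf _ (ucs_groupV (fZ x))) mulg1 mulgVK.
have iB : bijective (idfun : G -> G) by exists idfun.
have cE x : x * f x = x.
  apply: (autX (f := cA) (g := idfun) cB iB) => y Xy /=.
  by rewrite /c Xf // mulg1.
by move=> a; apply: (mulgI a); rewrite cE mulg1.
Qed.

(** The hypothesis on y passes to every [y, g] with one entry fewer: for a fixed
    list s the commutator of [y, g] with s is a homomorphism in g to which
    [Aut_basis_central_hom] applies. *)
Lemma Aut_basis_ucs k y : Z k.+1 y ->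
    (forall s, size s = k -> {in s, forall h, X h} -> commgs y s = 1) ->
  Z k y.
Proof.
elim: k y => [y _ ys|k IH y yZ ys]; first exact: (ys [::]).
have /ucsP yZ' := yZ.
apply/ucsP => g; apply: IH => // s sk sX.
apply: (Aut_basis_central_hom (f := fun a => commgs [~ y, a] s)).
- by apply: commgs_commg_morph; rewrite sk.
- by move=> a; apply: commgs_ucs; rewrite sk addn1.
- by move=> a aZ; rewrite commg_ucs1 // commgs1.
- move=> x Xx; apply: (ys (x :: s)) => [|h]; first by rewrite /= sk.
  by rewrite inE => /predU1P[->|/sX].
Qed.

End AutBasis.

(** * Long commutators with a nilpotent subnormal subgroup *)

Section SubnormalNilpotent.
Local Open Scope group_scope.
Variables (G : groupType) (H : set G).

Lemma commgs_ucs_nilpotent c y s : ucs H c y -> {in s, forall h, H h} ->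
  size s = c -> commgs y s = 1.
Proof.
elim: s c y => [|h s IH] [|c] y //= [_ yZ] sH [sc].
apply: (IH c) => // [|a sa]; last by apply: sH; rewrite inE sa orbT.
by apply: yZ; apply: sH; apply: mem_head.
Qed.

Lemma commg_normal_in (N K : set G) y h : normal_in N K -> K y -> N h ->
  N [~ y, h].
Proof.
move=> [Ngrp _ _ NK] Ky Nh; rewrite commgEr -in_setE.
have h_in : h \in N by rewrite in_setE.
apply: group_closedM => //; rewrite in_setE; apply: NK => //.
by rewrite -in_setE; apply: group_closedV.
Qed.

Hypothesis subnH : subnormal H.

(** Each commutator with an element of H, which lies in every term of the
    subnormal chain, descends one step along that chain. *)
Lemma subnormal_commgs : exists n, forall y s, {in s, forall h, H h} ->
  size s = n -> H (commgs y s).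
Proof.
have [_ [n [K [K0 Kn Knorm]]]] := subnH.
have HK i : (i <= n)%N -> H `<=` K i.
  elim: i => [|i IH] lt_in; first by rewrite K0.
  by have [_ _ KK _] := Knorm i lt_in; apply: subset_trans KK; apply/IH/ltnW.
suff desc i y s : (i <= n)%N -> K i y -> {in s, forall h, H h} ->
    size s = i -> H (commgs y s).
  by exists n => y s sH sn; apply: (desc n) => //; rewrite Kn.
elim: i y s => [|i IH] y [|h s] //= lt_in Ky sH; first by rewrite -K0.
move=> [sn]; apply: IH => //; first exact: ltnW.
  apply: commg_normal_in (Knorm _ lt_in) Ky _.
  by apply: HK (ltnW lt_in) _ _; apply: sH; apply: mem_head.
by move=> a sa; apply: sH; rewrite inE sa orbT.
Qed.

Lemma subnormal_nilpotent_commgs1 : nilpotent H ->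
  exists m, forall y s, {in s, forall h, H h} -> size s = m -> commgs y s = 1.
Proof.
move=> [c Hc]; have [n Hn] := subnormal_commgs.
exists (n + c)%N => y s sH ss; rewrite -(cat_take_drop n s) /commgs foldl_cat.
apply: (commgs_ucs_nilpotent (c := c)).
- rewrite Hc; apply: Hn; first by move=> h /mem_take/sH.
  by rewrite size_take ss; case: ltngtP (leq_addr c n) => // <-.
- by move=> h /mem_drop/sH.
- by rewrite size_drop ss addKn.
Qed.

End SubnormalNilpotent.

(** * The hypercentre and stability of a central series *)

Section HypercentreFinite.
Local Open Scope group_scope.
Variable G : groupType.

Local Notation Z := (ucs [set: G]).

(** A stationary term of the finite upper central series bounds all the terms of
    its transfinite continuation. *)
Lemma hypercentre_sub_ucs m : Z m.+1 `<=` Z m -> hypercentre G `<=` Z m.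
Proof.
move=> Zm; have [I [R [U [i [wo uU <- _]]]]] := hypercentreP G.
have cZ : centre_mod [set: G] (Z m) = Z m.
  by apply/seteqP; split; [exact: Zm | exact: ucs_ascending].
exact: (transfinite_ucs_sub wo uU (ucs_group1 G m) cZ).
Qed.

(** The elements acting i steps down the upper central series: they form the
    substitute for the i-th term of the lower central series of G. *)
Definition ucs_lowering i : set G :=
  [set a | forall j x, Z (j + i)%N x -> Z j [~ x, a]].

Lemma ucs_lowering1 a : ucs_lowering 1 a.
Proof. by move=> j x; rewrite addn1 => /ucsP. Qed.

(** A case of the three subgroups lemma. For x' conjugate to x, the images of x'
    under a b and b a differ by [w, a], [z, w] and [z, b], where z = [x', a]
    and w = [x', b]; each of these has gone down i + 1 steps. *)
Lemma ucs_lowering_commg i a b : ucs_lowering i a -> ucs_lowering i.+1 [~ a, b].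
Proof.
move=> aL j x xZ.
(* [a, b] is (b a)^-1 (a b), so starting from x' compares the actions of b a and
   a b on one element. *)
pose x' := x ^ (b * a)^-1.
have x'Z : Z (j + i).+1 x' by rewrite -addnS; apply: ucs_conj.
have -> : [~ x, [~ a, b]] = (x' ^ (b * a))^-1 * x' ^ (a * b).
  rewrite /x' conjgKV commgEl -conjgM; congr (_ * _ ^ _).
  by rewrite commgEl /conjg invgM !mulgA.
set z := [~ x', a]; set w := [~ x', b].
have zZ : Z j.+1 z by apply: aL.
have wZ : Z (j + i) w by apply: ucsS_commg.
have -> : (x' ^ (b * a))^-1 * x' ^ (a * b) =
    [~ w, a]^-1 * [~ z, w]^-1 * [~ z, b].
  have -> : x' ^ (b * a) = x' * z * (w * [~ w, a]).
    by rewrite conjgM [x' ^ b]conjg_mulR conjMg -!conjg_mulR.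
  have -> : x' ^ (a * b) = x' * w * (z * [~ z, b]).
    by rewrite conjgM [x' ^ a]conjg_mulR conjMg -!conjg_mulR.
  (* What is left is a word identity in x', z, w, p and q. *)
  rewrite (invgR z w); move: [~ w, a] [~ z, b] => p q; clearbody z w x'.
  by rewrite (commgEl w z) /conjg !invgM !mulgA mulgVK.
apply: ucs_groupM; last exact: ucsS_commg.
apply: ucs_groupM; apply: ucs_groupV; first exact: aL.
exact: ucsS_commg.
Qed.

(** Elements acting m + 1 steps down centralize Z_(m+1), hence X, so they are
    central. Since commutators act one step further down, elements acting
    m + 1 - i steps down lie in Z_(i+1); for i = m this is all of G. *)
Lemma nilpotent_of_cent_ucs (X : set G) m : X `<=` Z m.+1 ->
  (forall g, (forall x, X x -> [~ x, g] = 1) -> Z 1%N g) -> nilpotent [set: G].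
Proof.
move=> XZ cX.
suff LZ i : (i <= m)%N -> ucs_lowering (m.+1 - i)%N `<=` Z i.+1.
  exists m.+1; apply/seteqP; split=> // a _.
  by apply: (LZ m) => //; rewrite subSnn; apply: ucs_lowering1.
elim: i => [_ a aL|i IH lt_im a aL].
  by apply: cX => x Xx; apply: (aL 0%N); apply: XZ.
apply/ucsP => b; apply: IH; first exact: ltnW.
by rewrite subSn 1?ltnW //; apply: ucs_lowering_commg.
Qed.

End HypercentreFinite.

Theorem theorem1p13 (G : groupType) (H : set G) (HH : nilpotent H)
    (subnH : subnormal H) (hypH : H `<=` hypercentre G) (autH : Aut_basis H) :
  nilpotent [set: G].
Proof.
have [m Hm] := subnormal_nilpotent_commgs1 subnH HH.
apply: (@nilpotent_of_cent_ucs G H m); last exact: Aut_basis_cent.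
apply: subset_trans (@ucs_ascending G m).
apply: subset_trans hypH _; apply: hypercentre_sub_ucs => y yZ.
by apply: (Aut_basis_ucs autH yZ) => s sm sH; apply: Hm.
Qed.
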